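(* Let $X \neq \{0\}$ be a separable Banach space, let $(T(t))_{t\ge 0}$ be a $C_0$-semigroup on $X$, and let $u_{\mathrm{ref}}\in X$ be a reference trajectory, i.e. $T(t)u_{\mathrm{ref}}=u_{\mathrm{ref}}$ for all $t\ge 0$. If $(T(t))_{t\ge 0}$ is Devaney chaotic (with respect to the norm topology), then $(T(t))_{t\ge 0}$ is chaotic relative to $u_{\mathrm{ref}}$; moreover, the set of initial states $u_0\in X$ whose trajectory is relatively chaotic with respect to $u_{\mathrm{ref}}$ is dense in $X$.
   Context: Devaney chaotic: there is $x\in X$ whose orbit $\{T(t)x: t\ge 0\}$ is dense in $X$ (hypercyclicity), and the set of periodic points $\{x\in X: \exists\, t_0>0,\ T(t_0)x=x\}$ is dense in $X$. The trajectory of $u_0\in X$ is relatively chaotic with respect to $u_{\mathrm{ref}}$ if $\liminf_{t\to\infty}\|T(t)u_0-T(t)u_{\mathrm{ref}}\|=0$ and $\limsup_{t\to\infty}\|T(t)u_0-T(t)u_{\mathrm{ref}}\|=+\infty$. The semigroup is chaotic relative to $u_{\mathrm{ref}}$ if the set of $u_0\in X$ whose trajectory is relatively chaotic with respect to $u_{\mathrm{ref}}$ is dense in $X$. *)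

(* Defs.v *)
From HB Require Import structures.
From mathcomp Require Import all_boot all_order all_algebra.
From mathcomp Require Import complex.
From mathcomp Require Import all_classical all_reals all_analysis.

Set Implicit Arguments.
Unset Strict Implicit.
Unset Printing Implicit Defensive.

Import Order.TTheory GRing.Theory Num.Theory.
Import numFieldNormedType.Exports.

Local Open Scope classical_set_scope.
Local Open Scope ring_scope.

(* A Banach space is real or complex; time is always real.  In
   MathComp-Analysis the norm of a [normedModType K] takes its values in [K],
   so over the complex numbers [`|x|] is a complex number with zero imaginary
   part, and [real_norm] is the same number seen in [R]. *)
Variant scalar_kind := RealScalars | ComplexScalars.

Definition scalar_field (R : realType) (k : scalar_kind) : numFieldType :=
  match k with
  | RealScalars => R : numFieldType
  | ComplexScalars => (complex R) : numFieldType
  end.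

Definition scalar_re (R : realType) (k : scalar_kind) :
    scalar_field R k -> R :=
  match k with
  | RealScalars => fun a : R => a
  | ComplexScalars => fun a : complex R => complex.Re a
  end.

Definition separable (X : topologicalType) : Prop :=
  exists2 D : set X, countable D & dense D.

Section Semigroup.
Context {R : realType} {k : scalar_kind}.
Context {X : normedModType (scalar_field R k)}.

Definition real_norm (x : X) : R := scalar_re `|x|.

(* The family is indexed by all of [R]; its values at negative times are
   unconstrained and are never used below.  For linear maps between normed
   spaces, continuity is boundedness (see [linear_bounded_continuous]). *)
Implicit Types (T : R -> X -> X) (u uref x : X).

Record C0_semigroup T : Prop := {
  C0_linear : forall t, 0 <= t -> linear (T t);
  C0_continuous : forall t, 0 <= t -> continuous (T t);
  C0_id : forall x, T 0 x = x;
  C0_add : forall s t x, 0 <= s -> 0 <= t -> T (s + t) x = T s (T t x);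
  C0_strong : forall x, T t x @[t --> 0^'+] --> x
}.

Definition semigroup_orbit T x : set X := [set T t x | t in [set t : R | 0 <= t]].

Definition hypercyclic T : Prop := exists x, dense (semigroup_orbit T x).

Definition periodic_points T : set X :=
  [set x | exists t0 : R, 0 < t0 /\ T t0 x = x].

Definition Devaney_chaotic T : Prop :=
  hypercyclic T /\ dense (periodic_points T).

Definition reference_trajectory T uref : Prop :=
  forall t, 0 <= t -> T t uref = uref.

Definition relatively_chaotic_trajectory T uref u0 : Prop :=
  let d (t : R) : \bar R := (real_norm (T t u0 - T t uref))%:E in
  limf_einf d +oo%R = 0%E /\ limf_esup d +oo%R = +oo%E.

Definition chaotic_relative_to T uref : Prop :=
  dense [set u0 | relatively_chaotic_trajectory T uref u0].

End Semigroup.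

(* Main.v *)
Require Import Defs.
From HB Require Import structures.
From mathcomp Require Import all_boot all_order all_algebra.
From mathcomp Require Import complex.
From mathcomp Require Import all_classical all_reals all_analysis.
Import Order.TTheory GRing.Theory Num.Theory.
Import numFieldNormedType.Exports.
Local Open Scope classical_set_scope.
Local Open Scope ring_scope.

(** Hypercyclicity alone suffices: every point of a dense orbit [{T t x}] is
    relatively chaotic with respect to [uref].  Since [T r] is continuous and
    fixes [uref], it maps orbit points close to [uref] to points at times at
    least [r] that are still close to [uref], so the liminf is 0.  An orbit is
    bounded on every bounded time interval: near time 0 by strong continuity,
    then by iterating one bounded operator [T d].  A dense orbit in a nonzero
    space is unbounded, hence unbounded at arbitrarily late times, and the
    limsup is infinite. *)

Section RealLimits.
Context {R : realType}.
Implicit Types (f : R -> R) (g : R -> \bar R).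

(** The limsup is the infimum, over neighbourhoods of [+oo], of suprema; here these form the
    singleton [[set l]], nonempty because [setT] is a neighbourhood. *)
Lemma limf_esup_pinftyE g (l : \bar R) :
    (forall V, (\forall t \near +oo, V t) -> ereal_sup (g @` V) = l) ->
  limf_esup g +oo%R = l.
Proof.
move=> supE; rewrite /limf_esup.
suff -> : [set ereal_sup (g @` V) | V in (+oo%R : set_system R)] = [set l].
  by rewrite ereal_inf1.
apply/seteqP; split => [_ [V nV <-]|_ ->] /=; first exact: supE.
by exists setT; [exact: filterT | apply: supE; exact: filterT].
Qed.

Lemma limf_esup_unbounded f :
    (forall r A, exists2 t, r < t & A <= f t) ->
  limf_esup (EFin \o f) +oo%R = +oo%E.
Proof.
move=> f_unbounded; apply: limf_esup_pinftyE => V [r [_ rV]].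
apply/eqyP => A _; have [t rt Aft] := f_unbounded r A.
apply: (@le_trans _ _ (f t)%:E); first by rewrite lee_fin.
by apply: ereal_sup_ubound; exists t => //; exact: rV.
Qed.

Lemma limf_einf_eq0 f :
    (forall t, 0 <= f t) ->
    (forall r e, 0 < e -> exists2 t, r < t & f t <= e) ->
  limf_einf (EFin \o f) +oo%R = 0%E.
Proof.
move=> f_ge0 f_small; rewrite /limf_einf.
(* The liminf is the opposite of the limsup of [- f], whose supremum over every neighbourhood is
   0. *)
rewrite (_ : limf_esup _ _ = 0%E) ?oppe0//.
apply: limf_esup_pinftyE => V [r [_ rV]].
apply/eqP; rewrite eq_le; apply/andP; split.
  apply: ge_ereal_sup => _ [t _ <-] /=.
  by rewrite [leLHS](_ : _ = (- f t)%:E)// lee_fin oppr_le0.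
apply/lee_addgt0Pr => e e_gt0; have [t rt fte] := f_small r e e_gt0.
apply: (@le_trans _ _ ((- f t)%:E + e%:E)%E).
  by rewrite -EFinD lee_fin addrC subr_ge0.
by apply: leeD => //; apply: ereal_sup_ubound; exists t => //; exact: rV.
Qed.

End RealLimits.

Section Scalars.
Context {R : realType} {k : scalar_kind}.

(** A right inverse of [scalar_re], turning real thresholds into bounds for the scalar-valued
    norm. *)
Definition scalar_of : R -> scalar_field R k :=
  match k with
  | RealScalars => fun a : R => a
  | ComplexScalars => fun a : R => (a +i* 0)%C
  end.

Lemma scalar_ofK : cancel scalar_of (@scalar_re R k).
Proof. by rewrite /scalar_of; case: k. Qed.

Lemma scalar_of_gt0 (a : R) : 0 < a -> 0 < scalar_of a.
Proof. by rewrite /scalar_of; case: k => //= a_gt0; rewrite ltcE /= eqxx. Qed.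

Lemma scalar_re_le (a b : scalar_field R k) :
  a <= b -> scalar_re a <= scalar_re b.
Proof. by case: k a b => //= a b; rewrite lecE => /andP[]. Qed.

Lemma real_norm_ge0 (X : normedModType (scalar_field R k)) (x : X) :
  0 <= real_norm x.
Proof.
have -> : 0 = scalar_re (0 : scalar_field R k) by clear; case: k.
exact/scalar_re_le/normr_ge0.
Qed.

End Scalars.

Lemma exists_normE (K : numFieldType) (X : normedModType K) (a : K) :
  [set: X] <> [set 0] -> 0 <= a -> exists y : X, `|y| = a.
Proof.
move=> X_nontrivial a_ge0.
have [v v_neq0] : exists v : X, v != 0.
  apply/not_existsP => X0; apply: X_nontrivial; apply/seteqP; split => // v _ /=.
  by apply/eqP; apply: contrapT => /negP; exact: X0.
by exists ((a / `|v|) *: v); rewrite normrZ ger0_norm ?divr_ge0// divfK// normr_eq0.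
Qed.

Section Orbits.
Context {R : realType} {k : scalar_kind}.
Context {X : normedModType (scalar_field R k)} {T : R -> X -> X}.
Context (T_C0 : C0_semigroup T).
Implicit Types (x : X) (t : R).

Lemma C0_operator_bounded t : 0 <= t ->
  exists2 r, 0 <= r & forall x, `|T t x| <= r * `|x|.
Proof.
move=> t_ge0.
pose f : {linear X -> X} := HB.pack (T t)
  (GRing.isLinear.Build _ _ _ _ (T t) (C0_linear T_C0 t_ge0)).
have f_cont : continuous f by exact: (C0_continuous T_C0).
have /linear_bounded_continuous/linear_boundedP f_bounded := f_cont.
by have [r r_ge0 fr] := pinfty_ex_ge (@real0 _) f_bounded; exists r.
Qed.

Lemma C0_orbit_bounded_near0 x :
  exists2 d : R, 0 < d & forall t, 0 <= t <= d -> `|T t x| <= `|x| + 1.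
Proof.
have /cvgrPdist_le/(_ 1 ltr01) := C0_strong T_C0 (x := x).
case=> e /= e_gt0 near_e.
(* Halving [e] puts the closed interval inside the open ball of radius [e]. The limit concerns
   positive times only, so time 0 is treated apart. *)
exists (e / 2); first by rewrite divr_gt0.
move=> t /andP[]; rewrite le_eqVlt => /predU1P[<- _|t_gt0 te].
  by rewrite (C0_id T_C0) lerDl.
rewrite addrC -lerBlDr (le_trans _ (near_e t _ t_gt0)) //; last first.
  rewrite /= sub0r normrN gtr0_norm// (le_lt_trans te)//.
  by rewrite ltr_pdivrMr// ltr_pMr// ltr1n.
by rewrite distrC lerB_dist.
Qed.

Lemma C0_orbit_bounded x (r : R) :
  exists2 M, 0 <= M & forall t, 0 <= t <= r -> `|T t x| <= M.
Proof.
have [d d_gt0 near0] := C0_orbit_bounded_near0 x.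
have [c c_ge0 Tc] := C0_operator_bounded _ (ltW d_gt0).
suff iter n : exists2 M, 0 <= M &
    forall t, 0 <= t <= n%:R * d -> `|T t x| <= M.
  (* This many steps of length [d] cover the interval from 0 to [r]. *)
  have [M M_ge0 TM] := iter (Num.truncn (r / d)).+1.
  exists M => // t /andP[t_ge0 tr]; apply: TM; rewrite t_ge0/=.
  apply: (le_trans tr).
  by rewrite -ler_pdivrMr//; apply/ltW; exact: truncnS_gt.
elim: n => [|n [M M_ge0 TM]].
  exists `|x| => // t; rewrite mul0r -eq_le => /eqP <-.
  by rewrite (C0_id T_C0).
(* The sum dominates both cases: [|x| + 1] serves times up to [d], and [c * M] serves later ones,
   through [T t x = T d (T (t - d) x)]. *)
exists (`|x| + 1 + c * M); first by rewrite addr_ge0 ?addr_ge0 ?mulr_ge0.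
move=> t /andP[t_ge0 tnd]; have [td|/ltW dt] := leP t d.
  apply: (le_trans (near0 t _)); first by rewrite t_ge0.
  by rewrite lerDl mulr_ge0.
have td_ge0 : 0 <= t - d by rewrite subr_ge0.
rewrite -(subrK d t) addrC (C0_add T_C0 _ (ltW d_gt0) td_ge0).
apply: (le_trans (Tc _)); apply: (@le_trans _ _ (c * M)).
  apply: ler_wpM2l => //; apply: TM; rewrite td_ge0/= lerBlDr.
  by rewrite -[X in _ + X]mul1r -mulrDl natr1.
by rewrite lerDr addr_ge0.
Qed.

(** If [M] bounds the orbit up to time [r], the orbit still enters the unit ball around a point of
    norm [a + M + 1]. There its norm exceeds [a + M], which forces a time after [r]. *)
Lemma dense_orbit_unbounded x (r : R) (a : scalar_field R k) :
    [set: X] <> [set 0] -> dense (semigroup_orbit T x) -> 0 <= a ->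
  exists2 t, r < t & a <= `|T t x|.
Proof.
move=> X_nontrivial x_dense a_ge0.
have [M M_ge0 TM] := C0_orbit_bounded x r.
have [y yE] := exists_normE _ _ (a + M + 1) X_nontrivial
  (addr_ge0 (addr_ge0 a_ge0 M_ge0) ler01).
have [|z [/= yz [t t_ge0 Tt]]] := x_dense (ball y 1) _ (ball_open _ _).
  by exists y; exact: (ballxx _ ltr01).
move: yz; rewrite -Tt -ball_normE /= => yTt.
have aMTt : a + M < `|T t x|.
  rewrite -(ltrD2r 1) -yE -ltrBlDl.
  by rewrite (le_lt_trans _ yTt)// lerB_dist.
exists t; last by rewrite (le_trans _ (ltW aMTt))// lerDl.
rewrite ltNge; apply/negP => tr.
have /(TM t) : 0 <= t <= r by rewrite tr andbT.
by move=> /(lt_le_trans aMTt); rewrite gtrDr le_gtF.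
Qed.

Lemma dense_orbit_returns x uref (r : R) (e : scalar_field R k) :
    dense (semigroup_orbit T x) -> reference_trajectory T uref ->
    0 <= r -> 0 < e ->
  exists2 t, r <= t & `|T t x - uref| < e.
Proof.
move=> x_dense uref_ref r_ge0 e_gt0.
have : T r y @[y --> uref] --> T r uref by exact: (C0_continuous T_C0).
rewrite (uref_ref _ r_ge0) => /cvgrPdist_lt/(_ e e_gt0).
(* [T r] sends the open neighbourhood [U] of [uref] into the [e]-ball around [uref]; the orbit meets
   [U] at some time [s], hence that ball at time [r + s]. *)
rewrite near_simpl /prop_near1 nbhsE => -[U [U_open Uuref] UT].
have [|z [/= Uz [s s_ge0 Ts]]] := x_dense U _ U_open; first by exists uref.
exists (r + s); first by rewrite lerDl.
by rewrite (C0_add T_C0 _ r_ge0 s_ge0) Ts distrC; exact: UT.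
Qed.

Lemma dense_orbit_relatively_chaotic x uref (s : R) :
    [set: X] <> [set 0] -> dense (semigroup_orbit T x) ->
    reference_trajectory T uref -> 0 <= s ->
  relatively_chaotic_trajectory T uref (T s x).
Proof.
move=> X_nontrivial x_dense uref_ref s_ge0.
have diffE t : 0 <= t -> T t (T s x) - T t uref = T (t + s) x - uref.
  by move=> t_ge0; rewrite (C0_add T_C0 _ t_ge0 s_ge0) uref_ref.
split.
  apply: (limf_einf_eq0 (fun t => _)) => [t|r e e_gt0].
    exact: real_norm_ge0.
  (* The term [s] absorbs the time shift, [|r|] allows for negative [r], and 1 makes the final
     inequality strict. *)
  have rs_ge0 : 0 <= `|r| + 1 + s by rewrite !addr_ge0.
  have [t rt Tt] := dense_orbit_returns _ _ _ _ x_dense uref_ref rs_ge0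
    (scalar_of_gt0 (k := k) _ e_gt0).
  have rts : `|r| + 1 <= t - s by rewrite lerBrDr.
  exists (t - s).
    by apply: lt_le_trans rts; rewrite (le_lt_trans (ler_norm r))// ltrDl.
  rewrite diffE; last by apply: le_trans rts; rewrite addr_ge0.
  rewrite subrK -[e](scalar_ofK (k := k)).
  exact/scalar_re_le/ltW.
apply: (limf_esup_unbounded (fun t => _)) => r A.
have A_gt0 : 0 < `|A| + 1 by rewrite ltr_wpDl.
(* Adding the norm of [uref] to the threshold compensates for subtracting [uref]. *)
have [t rt At] := dense_orbit_unbounded _ (`|r| + s) _ X_nontrivial x_dense
  (addr_ge0 (ltW (scalar_of_gt0 (k := k) _ A_gt0)) (normr_ge0 uref)).
have rts : `|r| < t - s by rewrite ltrBrDr.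
exists (t - s); first by rewrite (le_lt_trans (ler_norm r)).
rewrite diffE; last by rewrite (le_trans _ (ltW rts)).
rewrite subrK; apply: (@le_trans _ _ (`|A| + 1)).
  by rewrite (le_trans (ler_norm A))// lerDl.
rewrite -[`|A| + 1](scalar_ofK (k := k)); apply: scalar_re_le.
by apply: le_trans (lerB_dist _ _); rewrite lerBrDr.
Qed.

End Orbits.

Theorem theorem5p6 (R : realType) (k : scalar_kind)
    (X : completeNormedModType (scalar_field R k))
    (X_nontrivial : [set: X] <> [set 0]) (X_separable : separable X)
    (T : R -> X -> X) (T_C0 : C0_semigroup T)
    (uref : X) (uref_ref : reference_trajectory T uref) :
  Devaney_chaotic T ->
  chaotic_relative_to T uref /\
  dense [set u0 : X | relatively_chaotic_trajectory T uref u0].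
Proof.
move=> [[x x_dense] _].
(* Both conjuncts unfold to the same density statement. *)
suff chaotic : chaotic_relative_to T uref by [].
move=> U U_nonempty U_open.
have [u [Uu [s s_ge0 Tsx]]] := x_dense U U_nonempty U_open.
exists u; split => //; rewrite -Tsx.
exact: dense_orbit_relatively_chaotic.
Qed.
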